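(* Let $w$ be a finite word over the alphabet $\{a,b\}$ such that $w=a^{r_1}ba^{r_2}ba^{r_3}b\cdots a^{r_k}ba^{r_{k+1}}$, where $r_1,r_2,\dots,r_{k+1}$ are nonnegative integers. Let $\sigma$ be a permutation of $1,2,\dots,k+1$ such that $r_{\sigma(1)}\leq r_{\sigma(2)}\leq\cdots\leq r_{\sigma(k+1)}$. Let $m(w)$ denote the number of distinct nonempty powers of exponent at least $2$ in $w$ and let $|w|$ denote the length of $w$. Then $$m(w)+r_{\sigma(k)}\leq |w|-2.$$
   Context: For a word $u$ and a positive integer $j$, $u^j=uu\cdots u$ ($j$ copies of $u$) is called a power of exponent $j$; in particular $a^n$ is the word consisting of $n$ letters $a$ ($a^0$ is the empty word). In the displayed form of $w$, $k$ is the number of occurrences of the letter $b$ in $w$. A word $u$ is a factor of $w$ if $w=pus$ for some (possibly empty) words $p,s$. A nonempty power of exponent at least $2$ in $w$ is a nonempty factor of $w$ of the form $u^j$ with $u$ a word and $j\geq 2$ an integer; $m(w)$ counts such factors as distinct words (so each word is counted once, regardless of the number of its occurrences or its representations as a power).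
   Formalization: The letter a is required to occur in w and k ≥ 1 is assumed: for w = b^n (n ≥ 1) one has m(w) = n−1 and all r_i = 0, so the inequality n−1 ≤ n−2 fails, and for k = 0 the number r_{σ(k)} is undefined. *)

(* Defs.v *)
From HB Require Import structures.
From mathcomp Require Import all_boot.

Set Implicit Arguments.
Unset Strict Implicit.
Unset Printing Implicit Defensive.

Section Powers.
Variable T : eqType.
Implicit Types u v w : seq T.

Definition wpow u (j : nat) : seq T := flatten (nseq j u).

Definition factors w : seq (seq T) :=
  undup [seq take n (drop i w) | i <- iota 0 (size w).+1, n <- iota 0 (size w).+1].

(* The base and the exponent of a nonempty power v can be searched for among
   the prefixes of v and the integers 2 <= j <= size v, see is_powerP. *)
Definition is_power v : bool :=
  (v != [::]) &&
  has (fun n => has (fun j => v == wpow (take n v) j) (iota 2 (size v).-1))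
      (iota 0 (size v).+1).

(* The distinct nonempty powers of exponent at least 2 in w, each listed once;
   see mem_powers and powers_uniq. *)
Definition powers w : seq (seq T) := [seq v <- factors w | is_power v].

Definition m w : nat := size (powers w).

Lemma mem_factors v w : (v \in factors w) = infix v w.
Proof.
rewrite mem_undup; apply/allpairsP/infixP => [[[i n] /= [_ _ ->]]|[p [s ->]]].
  by exists (take i w), (drop n (drop i w)); rewrite !cat_take_drop.
exists (size p, size v); rewrite !mem_iota !add0n !ltnS !size_cat.
split=> /=; first exact: leq_addr.
  by rewrite addnCA; apply: leq_addr.
by rewrite drop_size_cat // take_size_cat.
Qed.

Lemma size_wpow u j : size (wpow u j) = j * size u.
Proof. by elim: j => //= j IHj; rewrite size_cat IHj mulSn. Qed.

Lemma is_powerP v :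
  reflect (v <> [::] /\ exists u j, 2 <= j /\ v = wpow u j) (is_power v).
Proof.
apply: (iffP andP) => [[/eqP v0 /hasP[n _ /hasP[j j2 /eqP ev]]]|].
  by split=> //; exists (take n v), j; move: j2; rewrite mem_iota => /andP[].
case=> /eqP v0 [u [j [j2 ev]]]; split=> //.
have sv : size v = j * size u by rewrite ev size_wpow.
have u0 : 0 < size u.
  by rewrite lt0n; apply: contra v0; rewrite -size_eq0 sv => /eqP->; rewrite muln0.
have lu : size u <= size v by rewrite sv leq_pmull // (leq_trans _ j2).
have lj : j <= size v by rewrite sv leq_pmulr.
apply/hasP; exists (size u); first by rewrite mem_iota add0n ltnS.
apply/hasP; exists j.
  by rewrite mem_iota j2 add2n; case: (size v) lj (leq_trans j2 lj).
suff -> : take (size u) v = u by rewrite -ev.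
by rewrite ev; case: j j2 {ev sv lj} => // j _; rewrite /wpow /= take_size_cat.
Qed.

Lemma mem_powers v w :
  reflect [/\ infix v w, v <> [::] & exists u j, 2 <= j /\ v = wpow u j]
          (v \in powers w).
Proof.
rewrite mem_filter mem_factors.
by apply: (iffP andP) => [[/is_powerP[? ?] ?]|[? ? ?]]; split=> //; apply/is_powerP.
Qed.

Lemma powers_uniq w : uniq (powers w).
Proof. by rewrite filter_uniq ?undup_uniq. Qed.

End Powers.

Definition letter : Type := bool.
HB.instance Definition _ := Finite.on letter.
Definition a : letter := false.
Definition b : letter := true.

(* a^{r_1} b a^{r_2} b ... a^{r_k} b a^{r_{k+1}}; the exponents are indexed from
   0, so that r_{i+1} is r i, and ord_max is the index of r_{k+1}. *)
Definition ab_word (k : nat) (r : 'I_k.+1 -> nat) : seq letter :=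
  flatten [seq nseq (r (widen_ord (leqnSn k) i)) a ++ [:: b] | i <- enum 'I_k]
  ++ nseq (r ord_max) a.

(* Main.v *)
(* The Rauzy graph of order n of w has the subwords of length n as vertices and
   those of length n + 1 as edges; it is connected.  For a primitive period
   p <= n, the factors of length n + 1 of a p-periodic infinite word form a circuit if
   they all occur in w.  The lexicographically largest edges of two such
   circuits are distinct, for otherwise the larger of the two Lyndon words would
   have a border.  Removing these edges, largest first, keeps the graph
   connected, and so does removing the edge a^n b as well when w contains a^n b
   followed later by a^n, which holds for n <= r_sigma(k).  Hence the number of
   circuits, plus 1 if n <= r_sigma(k), is at most
   #edges - #vertices + 1; summing over n telescopes to |w| - 2.  Finally the
   powers of w inject into the pairs (n, circuit of order n): if N rotations of
   a j-th power of period p occur in w, then the circuit is present for all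
   windows of length at most (j - 1) p + N. *)

Require Import Defs.
From mathcomp Require Import all_boot all_order all_algebra perm.
From mathcomp Require Import zify.

Set Implicit Arguments.
Unset Strict Implicit.
Unset Printing Implicit Defensive.

(** * Colourings of graphs and injective relations *)

(** This replaces counting connected components: each new edge merges at most two colour classes, so
    it costs at most one colour. *)
Lemma edge_colouring (T : eqType) (E : seq (T * T)) (V : seq T) :
  exists2 c : T -> T, {in E, forall e, c e.1 = c e.2}
    & size (undup V) <= size (undup (map c V)) + size E.
Proof.
elim: E => [|e E [c cE leV]]; first by exists id; rewrite // map_id addn0.
pose c' x := if c x == c e.1 then c e.2 else c x.
exists c' => [e'|].
  rewrite inE => /predU1P[->|/cE eq_c]; rewrite /c' ?eqxx ?eq_c //.
  by case: eqP.
suff : size (undup (map c V)) <= (size (undup (map c' V))).+1 by move=> /=; lia.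
apply: (@uniq_leq_size _ _ (c e.1 :: undup (map c' V))); first exact: undup_uniq.
move=> _ /[!mem_undup]/mapP[x xV ->]; rewrite inE mem_undup.
case: (boolP (c x == c e.1)) => //= ne; apply/mapP; exists x => //.
by rewrite /c' (negPf ne).
Qed.

Lemma matching_image (S T : eqType) (P : S -> T -> Prop) (s : seq S) :
  uniq s -> {in s, forall x, exists y, P x y} ->
  (forall x x' y, P x y -> P x' y -> x = x') ->
  exists t, [/\ uniq t, size t = size s
    & {in t, forall y, exists2 x, x \in s & P x y}].
Proof.
move=> + + injP; elim: s => [_ _|x s IHs /= /andP[xs us] ex]; first by exists [::].
have [t [ut st inP]] : exists t, [/\ uniq t, size t = size s
    & {in t, forall y, exists2 x, x \in s & P x y}].
  by apply: IHs => // y ys; apply: ex; rewrite inE ys orbT.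
have [y Pxy] := ex x (mem_head _ _).
exists (y :: t); split; rewrite /= ?st // ?ut ?andbT.
  by apply/negP => /inP[x' x's /(injP _ _ _ Pxy) eqx]; rewrite eqx x's in xs.
move=> y'; rewrite inE => /predU1P[->|/inP[x' x's]]; first by exists x => //; exact: mem_head.
by exists x' => //; rewrite inE x's orbT.
Qed.

(** * Periodic infinite words and their largest windows *)

Section InfiniteWords.
Implicit Types (f g : nat -> letter) (s t : seq letter).

Definition window f i m : seq letter := mkseq (fun k => f (i + k)) m.

Lemma size_window f i m : size (window f i m) = m.
Proof. exact: size_mkseq. Qed.

Lemma windowD f i l m : window f i (l + m) = window f i l ++ window f (i + l) m.
Proof.
rewrite /window /mkseq iotaD map_cat add0n; congr (_ ++ _).
by rewrite -{1}[l]addn0 iotaDl -map_comp; apply: eq_map => k /=; rewrite addnA.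
Qed.

Lemma eq_window f g i m : f =1 g -> window f i m = window g i m.
Proof. by move=> e; apply: eq_mkseq. Qed.

Lemma window_inj f g i j m :
  window f i m = window g j m -> forall k, k < m -> f (i + k) = g (j + k).
Proof.
by move=> e k km; move/(congr1 (fun s => nth a s k)): e; rewrite !nth_mkseq.
Qed.

Lemma window_infix f i j l m :
  i <= j -> j + l <= i + m -> infix (window f j l) (window f i m).
Proof.
move=> ij jl; apply/infixP.
exists (window f i (j - i)), (window f (j + l) (i + m - (j + l))).
have {1}-> : m = (j - i) + (l + (i + m - (j + l))) by lia.
by rewrite !windowD subnKC.
Qed.

(** With [b] as the binary digit 1, this is the lexicographic order on words of equal length. *)
Definition binval s : nat := foldl (fun n (x : bool) => n.*2 + x) 0 s.

Lemma binval_cat s t : binval (s ++ t) = binval s * 2 ^ size t + binval t.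
Proof.
rewrite /binval foldl_cat; set n := foldl _ 0 s.
elim/last_ind: t => [|t x IHt]; first by rewrite /= expn0; lia.
by rewrite !foldl_rcons IHt size_rcons expnS; lia.
Qed.

Lemma binval_lt s : binval s < 2 ^ size s.
Proof.
elim/last_ind: s => [//|s x]; rewrite /binval foldl_rcons size_rcons expnS.
by case: (x : bool); lia.
Qed.

Lemma binval_inj s t : size s = size t -> binval s = binval t -> s = t.
Proof.
elim/last_ind: s t => [|s x IHs] t; first by case: t.
case/lastP: t => [|t y]; rewrite !size_rcons // => -[/IHs{}IHs].
rewrite /binval !foldl_rcons => e.
have exy : x = y by case: x y e => [] [] //=; lia.
by rewrite exy IHs // /binval; move: e; rewrite exy; lia.
Qed.

Lemma binval_take s s' t t' : size s = size s' -> size t = size t' ->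
  binval (s ++ t) <= binval (s' ++ t') -> binval s <= binval s'.
Proof.
rewrite !binval_cat => _ -> le; rewrite leqNgt; apply/negP => lt.
have := binval_lt t'; have := leq_mul lt (leqnn (2 ^ size t')).
by rewrite mulSn; lia.
Qed.

Definition periodic f p := forall i, f (i + p) = f i.

Definition primitive_period f p :=
  [/\ 0 < p, periodic f p & forall d, 0 < d < p -> ~ periodic f d].

Lemma periodicM f p q : periodic f p -> periodic f (q * p).
Proof.
move=> fp i; elim: q => [|q IHq]; first by rewrite addn0.
by rewrite mulSn [p + _]addnC addnA fp.
Qed.

Lemma periodic_mod f p i : periodic f p -> f (i %% p) = f i.
Proof. by move=> fp; rewrite {2}(divn_eq i p) addnC periodicM. Qed.

Lemma periodic_window f p i m : periodic f p -> window f (i %% p) m = window f i m.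
Proof.
move=> fp; apply: eq_mkseq => k.
by rewrite -[LHS](periodic_mod _ fp) -[RHS](periodic_mod _ fp) modnDml.
Qed.

Lemma periodic_range f p l d : 0 < p -> periodic f p -> p <= l ->
  (forall i, i < l -> f (i + d) = f i) -> periodic f d.
Proof.
move=> p0 fp pl fd i; rewrite -[RHS](periodic_mod _ fp) -[RHS]fd.
  by rewrite -[RHS](periodic_mod _ fp) modnDml periodic_mod.
by apply: leq_trans pl; rewrite ltn_mod.
Qed.

(* The window [f 0], ..., [f (l - 1)] is the largest edge of the circuit of
   period [p] in the Rauzy graph of order [l - 1]; as [p < l], it fixes [f]. *)
Definition maximal_window f p l :=
  [/\ primitive_period f p, p < l
    & forall i, binval (window f i l) <= binval (window f 0 l)].

(** If [p < q], the prefix of length [q - p] recurs at position [p]. Maximality against the shifts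
    by [p] and [q - p] then forces the prefix of length [l - (q - p)] to recur at [q - p]. Hence [p]
    is a period of [g], against the primitivity of [q]. *)
Lemma maximal_window_period f g p q l :
  maximal_window f p l -> maximal_window g q l ->
  window f 0 l = window g 0 l -> q <= p.
Proof.
case=> -[p0 fp _] pl _ [[q0 gq gmin] ql gmax] e; rewrite leqNgt; apply/negP => pq.
have efg k : k < l -> f k = g k by move=> kl; exact: (window_inj e).
have gp k : k + p < l -> g (k + p) = g k by move=> kl; rewrite -!efg ?fp //; lia.
have el : l = q - p + (l - (q - p)) by lia.
have el' : l = l - (q - p) + (q - p) by lia.
set r := l - (q - p) in el el'.
have pre : window g p (q - p) = window g 0 (q - p).
  have /eq_in_map : {in iota 0 (q - p), forall k, g (p + k) = g (0 + k)}.
    by move=> k; rewrite mem_iota => kq; rewrite addnC gp //; lia.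
  by [].
have le1 : binval (window g 0 r) <= binval (window g (q - p) r).
  have := gmax p; rewrite {1 2}el !windowD pre !binval_cat !size_window.
  rewrite leq_add2l add0n subnKC; last exact: ltnW.
  by rewrite -(periodic_window q r gq) modnn.
have le2 : binval (window g (q - p) r) <= binval (window g 0 r).
  have := gmax (q - p); rewrite {1 2}el' !windowD.
  by apply: binval_take; rewrite !size_window.
have /window_inj er : window g 0 r = window g (q - p) r.
  by apply: binval_inj; rewrite ?size_window //; apply/eqP; rewrite eqn_leq le1.
apply: (gmin p); first by rewrite p0.
apply: (@periodic_range g q q) => // i iq.
have [iqp|qpi] := ltnP i (q - p); first by rewrite gp //; lia.
have -> : i + p = i - (q - p) + q by lia.
rewrite gq -[i - (q - p)]add0n er; last by rewrite /r; lia.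
by rewrite subnKC.
Qed.

Lemma maximal_window_inj f g p q l l' :
  maximal_window f p l -> maximal_window g q l' ->
  window f 0 l = window g 0 l' -> [/\ p = q, l = l' & f =1 g].
Proof.
move=> Mf Mg e; have el : l = l' by rewrite -(size_window f 0 l) e size_window.
move: Mf e; rewrite {}el => Mf e.
have epq : p = q.
  apply/eqP; rewrite eqn_leq (maximal_window_period Mg Mf) //.
  by rewrite (maximal_window_period Mf Mg).
split=> // i; case: Mf Mg => -[p0 fp _] pl _ [[_ gq _] _ _].
rewrite -(periodic_mod i fp) -(periodic_mod i gq) epq.
apply: (window_inj e); rewrite -epq; apply: leq_trans pl.
by rewrite ltnW // ltnS ltn_mod.
Qed.

End InfiniteWords.

(** * Removable edges of Rauzy graphs *)

Section RauzyGraphs.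
Variable w : seq letter.
Implicit Types (v z : seq letter) (c : seq letter -> seq letter).

Definition subwords n := [seq v <- factors w | size v == n].

Lemma mem_subwords n v : (v \in subwords n) = (size v == n) && infix v w.
Proof. by rewrite mem_filter mem_factors. Qed.

Lemma subwords_uniq n : uniq (subwords n).
Proof. by rewrite filter_uniq ?undup_uniq. Qed.

Lemma subwordsP n v :
  reflect (exists2 i, i + n <= size w & v = take n (drop i w)) (v \in subwords n).
Proof.
rewrite mem_subwords; apply: (iffP andP) => [[/eqP <- /infixP[]]|[i le ->]].
  move=> p' [s' e]; pose p : seq letter := p'; pose s : seq letter := s'.
  rewrite {}e -/p -/s.
  exists (size p); first by rewrite !size_cat; lia.
  by rewrite drop_size_cat // take_size_cat.
split; first by rewrite size_takel // size_drop; lia.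
by apply/infixP; exists (take i w), (drop n (drop i w)); rewrite !cat_take_drop.
Qed.

Lemma behead_slice n i : i < size w ->
  behead (take n.+1 (drop i w)) = take n (drop i.+1 w).
Proof. by move=> iw; rewrite (drop_nth a iw). Qed.

(* The edges of the Rauzy graph of order [n] are the subwords [z] of length
   [n.+1], going from [take n z] to [behead z]. *)
Definition constant_on c n z := c (take n z) = c (behead z).

Lemma constant_slice c n i : i < size w ->
  constant_on c n (take n.+1 (drop i w)) ->
  c (take n (drop i w)) = c (take n (drop i.+1 w)).
Proof. by move=> iw; rewrite /constant_on take_takel // behead_slice. Qed.

(** Connectivity without [X] is expressed by colourings: constancy along the remaining edges must
    imply constancy along all of them. *)
Lemma edges_le_vertices n (X : seq (seq letter)) : n <= size w ->
  uniq X -> {subset X <= subwords n.+1} ->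
  (forall c, (forall z, z \in subwords n.+1 -> z \notin X -> constant_on c n z) ->
    forall z, z \in subwords n.+1 -> constant_on c n z) ->
  size (subwords n) + size X <= (size (subwords n.+1)).+1.
Proof.
move=> nw uX sX connected.
pose E := [seq z <- subwords n.+1 | z \notin X].
have [c cE] := edge_colouring [seq (take n z, behead z) | z <- E] (subwords n).
rewrite undup_id ?subwords_uniq // size_map => leV.
have cst := connected c _.
have {cst}{}cE : forall z, z \in subwords n.+1 -> constant_on c n z.
  apply: cst => z zw zX; apply: (cE (_, _)); apply/mapP; exists z => //.
  by rewrite mem_filter zX.
have leE : size E + size X <= size (subwords n.+1).
  rewrite -size_cat; apply: uniq_leq_size => [|z].
    rewrite cat_uniq uX filter_uniq ?subwords_uniq // andbT /=.
    by apply/hasPn => z zX; rewrite mem_filter zX.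
  by rewrite mem_cat mem_filter => /orP[/andP[]|/sX].
suff le1 : size (undup (map c (subwords n))) <= 1.
  rewrite -add1n; apply: leq_trans (leq_add (leqnn 1) leE).
  by rewrite addnA leq_add2r (leq_trans leV) // leq_add2r.
(* The slices of [w], read from left to right, walk through all vertices, so only one colour is
   left. *)
apply: (@uniq_leq_size _ _ [:: c (take n (drop 0 w))]); first exact: undup_uniq.
move=> _ /[!mem_undup]/mapP[_ /subwordsP[i + ->] ->]; rewrite inE.
elim: i => [//|i IHi] iw; rewrite -constant_slice; first by apply: IHi; lia.
  by lia.
by apply: cE; apply/subwordsP; exists i; rewrite // -addSnnS.
Qed.

Definition circuit_edge z := exists f p, [/\ maximal_window f p (size z),
  z = window f 0 (size z) & forall i, infix (window f i (size z)) w].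

Definition last_run n : seq letter := rcons (nseq n a) b.

(** A period [p <= n] would equate the final [b] with an [a] standing [p] places earlier. *)
Lemma last_run_not_window f p n i : 0 < p -> periodic f p -> p <= n ->
  window f i n.+1 <> last_run n.
Proof.
move=> p0 fp pn e.
have fn k : k <= n -> f (i + k) = nth a (last_run n) k.
  by move=> kn; rewrite -e nth_mkseq.
have := fn (n - p) (leq_subr _ _); rewrite -fp -addnA subnK // fn //.
rewrite /last_run !nth_rcons size_nseq ltnn eqxx nth_nseq.
by have -> : n - p < n by lia.
Qed.

(* Going around a circuit the other way replaces its largest edge by smaller
   ones, so induction on the order of words puts all the edges back. *)
Lemma circuit_edges_removable c n (D X : seq (seq letter)) :
  {in D, forall z, circuit_edge z} -> {subset X <= [:: last_run n]} ->
  (forall z, z \in subwords n.+1 -> z \notin D ++ X -> constant_on c n z) ->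
  forall z, z \in subwords n.+1 -> z \notin X -> constant_on c n z.
Proof.
move=> DC sX cst z; have [k] := ubnP (binval z).
elim: k z => // k IHk z /ltnSE zk zw zX.
have [zD|zD] := boolP (z \in D); last first.
  by apply: cst; rewrite // mem_cat negb_or zD.
have [f [p]] := DC z zD; move: zw; rewrite mem_subwords => /andP[/eqP-> _].
case=> -[[p0 fp fmin] pn fmax] ez fw.
(* A shift giving an equal window would be a period below [p], so these edges are strictly
   smaller. *)
have smaller i : 0 < i < p -> constant_on c n (window f i n.+1).
  move=> /andP[i0 ip]; apply: IHk; last 2 first.
  - by rewrite mem_subwords size_window eqxx fw.
  - apply/negP => /sX; rewrite inE => /eqP.
    exact: (last_run_not_window p0 fp).
  apply: leq_trans zk; rewrite ez ltn_neqAle fmax andbT; apply/eqP => /binval_inj.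
  rewrite !size_window => /(_ erefl)/window_inj e.
  apply: (fmin i); first by rewrite i0.
  apply: (periodic_range p0 fp (ltnW pn)) => j jn.
  by rewrite addnC e.
have take_window i : take n (window f i n.+1) = window f i n.
  by rewrite -[X in window _ _ X]addn1 windowD take_size_cat ?size_window.
have behead_window i : behead (window f i n.+1) = window f i.+1 n.
  by rewrite -[n.+1]add1n windowD /= addn1.
have const1 i : i < p -> c (window f 1 n) = c (window f i.+1 n).
  elim: i => // i IHi ip; rewrite IHi 1?ltnW //.
  have := smaller i.+1 ip; by rewrite /constant_on take_window behead_window.
rewrite /constant_on ez take_window behead_window (const1 p.-1) ?prednK //.
by rewrite -(periodic_window p n fp) modnn.
Qed.

Definition returning_run n := exists i j, [/\ i < j, j + n <= size w,
  take n.+1 (drop i w) = last_run n & take n (drop j w) = nseq n a].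

Lemma last_run_removable c n : returning_run n ->
  (forall z, z \in subwords n.+1 -> z != last_run n -> constant_on c n z) ->
  constant_on c n (last_run n).
Proof.
case=> i [j [ij jw ei ej]] cst.
have take_run : take n (last_run n) = nseq n a.
  by rewrite /last_run -cats1 take_size_cat ?size_nseq.
have run_from d : d <= j -> c (take n (drop (j - d) w)) = c (nseq n a).
  elim: d => [|d IHd] dj; first by rewrite subn0 ej.
  (* The walk may cross the removed edge itself, but that edge starts at [nseq n a], where the claim
     is trivial. *)
  have [->//|ne] := eqVneq (take n (drop (j - d.+1) w)) (nseq n a).
  rewrite constant_slice; last 2 first.
  - by lia.
  - apply: cst; first by apply/subwordsP; exists (j - d.+1) => //; lia.
    by apply: contra ne => /eqP e; rewrite -[X in X == _](@take_takel _ n n.+1) // e take_run.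
  have -> : (j - d.+1).+1 = j - d by lia.
  by apply: IHd; lia.
rewrite /constant_on take_run -ei behead_slice; last by lia.
by rewrite -(run_from (j - i.+1)) ?leq_subr // subKn.
Qed.

(** The circuit edges are put back first, while the edge [last_run n] is still missing; that edge
    follows. *)
Lemma subwords_growth n (D : seq (seq letter)) (run : bool) : n <= size w ->
  uniq D -> {in D, forall z, size z = n.+1 /\ circuit_edge z} ->
  (run -> returning_run n) ->
  size (subwords n) + size D + run <= (size (subwords n.+1)).+1.
Proof.
move=> nw uD DC runP; set X := nseq run (last_run n).
have DC' : {in D, forall z, circuit_edge z} by move=> z /DC[].
have sX : {subset X <= [:: last_run n]}.
  by move=> z; rewrite mem_nseq inE => /andP[].
rewrite -addnA; have -> : size D + run = size (D ++ X) by rewrite size_cat size_nseq.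
apply: edges_le_vertices => //.
- rewrite cat_uniq uD /=; apply/andP; split; last by rewrite /X; case: run {X sX runP}.
  apply/hasPn => z /sX; rewrite inE => /eqP->; apply/negP => /DC[ez].
  case=> f [p]; rewrite ez => -[[[p0 fp _] pn _] e _].
  exact: (last_run_not_window p0 fp pn (esym e)).
- move=> z; rewrite mem_cat => /orP[/DC[ez [f [p [_ e fw]]]]|].
    by rewrite mem_subwords ez eqxx e fw.
  rewrite mem_nseq => /andP[]; case: run {X sX} runP => // /(_ isT)[i [j]].
  case=> ij jw ei _ _ /eqP->; apply/subwordsP; exists i => //; lia.
move=> c /(circuit_edges_removable DC' sX) cst z zw.
have [zX|zX] := boolP (z \in X); last exact: cst.
move: (zX); rewrite mem_nseq => /andP[r0 /eqP->]; apply: last_run_removable.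
  by apply: runP; case: run r0 {X sX cst zX}.
by move=> z' z'w ne; apply: cst => //; apply: contra ne => /sX; rewrite inE.
Qed.

End RauzyGraphs.

(** * Injecting powers into circuit edges *)

Section PowersAsEdges.
Variable w : seq letter.
Implicit Types (f g : nat -> letter) (x z : seq letter).

Definition occurs f m i := infix (window f i m) w.

(* If [r] rotations of a [j]-th power occur in [w], every cyclic interval of
   [p - r + 1] starting positions contains that of such a rotation. *)
Lemma windows_covered f p j r : 0 < p -> 0 < j -> periodic f p ->
  0 < r <= count (occurs f (j * p)) (iota 0 p) ->
  forall i, occurs f (j.-1 * p + r) i.
Proof.
move=> p0 j0 fp /andP[r0 rc] i.
have rp : r <= p by rewrite (leq_trans rc) // (leq_trans (count_size _ _)) // size_iota.
pose S := [seq s <- iota 0 p | occurs f (j * p) s].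
pose I := [seq t %% p | t <- iota (i + r) (p - r).+1].
have sI : {subset S ++ I <= iota 0 p}.
  move=> s; rewrite mem_cat mem_filter => /orP[/andP[]//|/mapP[t _ ->]].
  by rewrite mem_iota ltn_mod.
have uI : uniq I.
  rewrite map_inj_in_uniq ?iota_uniq // => t t'; rewrite !mem_iota => tI t'I e.
  have et := divn_eq t p; have et' := divn_eq t' p; rewrite -e in et'.
  have := ltn_pmod t p0; case: (ltngtP (t %/ p) (t' %/ p)) => lt; last 1 first.
  - by rewrite et et' lt.
  - by have := leq_mul lt (leqnn p); rewrite mulSn; lia.
  - by have := leq_mul lt (leqnn p); rewrite mulSn; lia.
have : ~~ uniq (S ++ I).
  apply/negP => u; have := uniq_leq_size u sI.
  rewrite size_cat size_map !size_iota size_filter => le.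
  by have := leq_trans (leq_add rc (leqnn _)) le; lia.
rewrite cat_uniq uI filter_uniq ?iota_uniq // andbT negbK => /hasP[_ /mapP[t + ->]].
rewrite mem_iota mem_filter => tI /andP[+ _].
rewrite /occurs (periodic_window _ _ fp); apply: infix_trans.
(* The start [i] is moved to [i + p]: since [i + r <= t <= i + p], the window there lies inside the
   one at [t]. *)
rewrite -(periodic_window _ _ fp) -(modnDr i) (periodic_window _ _ fp).
by case: j j0 {rc S sI uI} => // j _; apply: window_infix; rewrite ?mulSn /=; lia.
Qed.

(** The position [s] is counted too, so the ranks of the occurring rotations start at 1. *)
Definition rank f p j s := count (occurs f (j * p)) (iota 0 s.+1).

Lemma rank_gt0 f p j s : occurs f (j * p) s -> 0 < rank f p j s.
Proof. by move=> os; rewrite /rank -[s.+1]addn1 iotaD count_cat /= os; lia. Qed.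

Lemma rank_le f p j s n : s < n ->
  rank f p j s <= count (occurs f (j * p)) (iota 0 n).
Proof. by move=> sn; rewrite -(subnKC sn) iotaD count_cat leq_addr. Qed.

Lemma rank_le_period f p j s : s < p -> rank f p j s <= p.
Proof.
by move=> sp; rewrite (leq_trans (count_size _ _)) // size_iota.
Qed.

Lemma rank_lt f p j s s' : s < s' -> occurs f (j * p) s' ->
  rank f p j s < rank f p j s'.
Proof.
move=> lt os; rewrite {2}/rank -[s'.+1]addn1 iotaD count_cat /= os.
by rewrite addn0 addn1 ltnS rank_le.
Qed.

(* The rotations of a [j]-th power that occur in [w] are sent to the largest
   windows of lengths [(j - 1) * p + 1], [(j - 1) * p + 2], ... *)
Definition edge_of_power x z := exists f p j s,
  [/\ primitive_period f p /\
        (forall i l, l <= j * p -> binval (window f i l) <= binval (window f 0 l)),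
      2 <= j /\ s < p, x = window f s (j * p) /\ infix x w
    & z = window f 0 (j.-1 * p + rank f p j s)].

Lemma edge_of_power_circuit x z : edge_of_power x z -> circuit_edge w z.
Proof.
case=> f [p [j [s [[[p0 fp fmin] fmax] [j2 sp] [-> xw] ->]]]].
have r0 := rank_gt0 xw; have rp := rank_le_period f j sp.
have ejp : j * p = j.-1 * p + p by case: j j2 {fmax xw r0 rp} => // j; rewrite mulSn addnC.
have jp : p <= j.-1 * p by rewrite leq_pmull //; lia.
exists f, p; rewrite size_window; split=> //.
  split=> //; first by lia.
  by move=> i; apply: fmax; rewrite ejp leq_add2l.
by apply: windows_covered; rewrite // ?r0 ?rank_le //; lia.
Qed.

(** The edge determines [f] up to pointwise equality, and [p]. As ranks lie between 1 and [p], its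
    length then determines [j] and the rank. The rank determines the rotation, being strictly
    increasing along those that occur. *)
Lemma edge_of_power_inj x x' z :
  edge_of_power x z -> edge_of_power x' z -> x = x'.
Proof.
have ejp j p : 2 <= j -> j * p = j.-1 * p + p.
  by case: j => // j; rewrite mulSn addnC.
have jp j p : 2 <= j -> p <= j.-1 * p by move=> j2; rewrite leq_pmull //; lia.
case=> f [p [j [s [[[p0 fp fmin] fmax] [j2 sp] [-> xw] ->]]]].
case=> g [q [k [t [[[q0 gq gmin] gmax] [k2 tq] [-> yw]]]]].
have := rank_gt0 xw; have := rank_le_period f j sp.
have := rank_gt0 yw; have := rank_le_period g k tq.
have := jp _ p j2; have := jp _ q k2.
set rf := rank f p j s; set rg := rank g q k t => kq jp' rgq rg0 rfp rf0.
case/(@maximal_window_inj _ _ p q).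
- by split=> // [|i]; [lia|apply: fmax; rewrite (ejp _ _ j2) // leq_add2l].
- by split=> // [|i]; [lia|apply: gmax; rewrite (ejp _ _ k2) // leq_add2l].
move=> epq; subst q => el efg.
have ejk : j = k.
  case: (ltngtP j.-1 k.-1) => lt; last by lia.
  - by have := leq_mul lt (leqnn p); rewrite mulSn; lia.
  - by have := leq_mul lt (leqnn p); rewrite mulSn; lia.
subst k.
have er : rank f p j s = rank f p j t.
  move: el => /addnI; rewrite /rf /rg => ->; apply: eq_count => i.
  by rewrite /occurs (eq_window _ _ efg).
rewrite -(eq_window _ _ efg) in yw *.
case: (ltngtP s t) => [lt|lt|->//].
  by have := rank_lt lt yw; rewrite er ltnn.
by have := rank_lt lt xw; rewrite er ltnn.
Qed.

Lemma nth_wpow (u : seq letter) j i : i < j * size u ->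
  nth a (wpow u j) i = nth a u (i %% size u).
Proof.
elim: j i => // j IHj i; rewrite mulSn /wpow /= nth_cat => lt.
have [iu|ui] := ltnP i (size u); first by rewrite modn_small.
rewrite -/(wpow u j) IHj; last by lia.
by rewrite -{2}(subnK ui) modnDr.
Qed.

Lemma primitive_periodP f q : 0 < q -> periodic f q ->
  exists p, primitive_period f p /\ p %| q.
Proof.
move=> q0 fq.
pose P d := (0 < d) && all (fun i => f (i + d) == f i) (iota 0 q).
have PP d : reflect (0 < d /\ periodic f d) (P d).
  apply: (iffP andP) => -[d0 fd]; split=> //; last by apply/allP => i _; rewrite fd.
  apply: (periodic_range q0 fq (leqnn q)) => i iq.
  by apply/eqP/(allP fd); rewrite mem_iota.
have exP : exists d, P d by exists q; apply/PP.
case: (ex_minnP exP) => p /PP[p0 fp] pmin; exists p; split.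
  split=> // d /andP[d0 dp] fd.
  by have := pmin d; rewrite leqNgt dp => H; have /H : P d by apply/PP.
rewrite /dvdn -leqn0 leqNgt; apply/negP => r0.
have /pmin : P (q %% p).
  apply/PP; split=> // i; rewrite -(periodicM (q %/ p) fp) -addnA.
  by rewrite [_ %% _ + _]addnC -divn_eq.
by rewrite leqNgt ltn_mod p0.
Qed.

Lemma edge_of_powerP x : x \in powers w -> exists z, edge_of_power x z.
Proof.
case/mem_powers => xw /eqP x0 [u [j [j2 ex]]].
have sx : size x = j * size u by rewrite ex size_wpow.
have u0 : 0 < size u.
  by rewrite lt0n; apply: contra x0; rewrite -size_eq0 sx => /eqP->; rewrite muln0.
pose g i := nth a u (i %% size u).
have gu : periodic g (size u) by move=> i; rewrite /g modnDr.
(* The base [u] may itself be a power; passing to its primitive period multiplies the exponent by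
   [k]. *)
have [p [[p0 gp gmin] /dvdnP[k ek]]] := primitive_periodP u0 gu.
have k0 : 0 < k by rewrite lt0n; apply: contraTneq u0 => k0; rewrite ek k0.
have exg : x = window g 0 (j * k * p).
  apply: (@eq_from_nth _ a) => [|i]; first by rewrite size_window sx ek mulnA.
  by rewrite sx ex => iu; rewrite nth_wpow // nth_mkseq // -mulnA -ek.
set L := j * k * p in exg.
(* The word [f] starts at the largest of the [p] rotations; [s] undoes this rotation modulo [p]. *)
have [t _ tmax] := @arg_maxnP _ (Ordinal p0) predT
  (fun t : 'I_p => binval (window g t L)) isT.
pose f i := g (t + i).
have fg i m : window f i m = window g (t + i) m.
  by apply: eq_mkseq => l; rewrite /f addnA.
pose s := (p - t) %% p.
have exf : x = window f s L.
  rewrite exg fg -[RHS](periodic_window _ _ gp) /s modnDmr subnKC ?modnn //.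
  exact/ltnW/ltn_ord.
exists (window f 0 ((j * k).-1 * p + rank f p (j * k) s)), f, p, (j * k), s.
split=> //.
- split; first split=> // [i|d dp fd]; first by rewrite /f addnA gp.
    apply: (gmin d dp) => i.
    rewrite -(periodicM t gp) -[RHS](periodicM t gp).
    (* Only the values of [g] from [t] on are seen by [f]; adding the multiple [t * p] of the period
       keeps the subtraction of [t] exact. *)
    have tp : t <= t * p by rewrite leq_pmulr.
    have := fd (i + t * p - t); rewrite /f addnA !subnKC; last by lia.
    by rewrite [i + d + _]addnAC.
  move=> i l; rewrite -/L => lL.
  have : binval (window f i L) <= binval (window f 0 L).
    rewrite !fg addn0 -(periodic_window _ _ gp).
    exact: (tmax (Ordinal (ltn_pmod (t + i) p0))).
  by rewrite -(subnKC lL) !windowD; apply: binval_take; rewrite !size_window.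
- by rewrite ltn_mod (leq_trans j2) // leq_pmulr.
Qed.

Lemma powers_as_edges : exists Z : seq (seq letter),
  [/\ uniq Z, size Z = m w & {in Z, forall z, circuit_edge w z}].
Proof.
have [Z [uZ sZ PZ]] :=
  matching_image (powers_uniq w) edge_of_powerP edge_of_power_inj.
by exists Z; split=> // z /PZ[x _ /edge_of_power_circuit].
Qed.

End PowersAsEdges.

(** * Summation over all orders *)

(** The bounds of [subwords_growth] for orders 1 to [K] telescope; the returning run adds 1 at each
    order up to [R], hence [minn R K]. *)
Lemma growth_sum (w : seq letter) (Z : seq (seq letter)) (R K : nat) :
  uniq Z -> {in Z, forall z, circuit_edge w z} ->
  (forall n, 0 < n <= R -> returning_run w n) -> K <= size w ->
  size (subwords w 1) + count (fun z => size z <= K.+1) Z + minn R K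
    <= size (subwords w K.+1) + K.
Proof.
move=> uZ CZ runs; elim: K => [_|K IHK Kw].
  (* Circuit edges have length at least 2, because [0 < p < size z]. *)
  suff /eqP-> : count (fun z : seq letter => size z <= 1) Z == 0 by rewrite minn0 !addn0.
  rewrite -leqn0 leqNgt -has_count; apply/hasPn => z /CZ[f [p [[[p0 _ _] pz _] _ _]]].
  by rewrite -ltnNge (leq_trans _ pz).
pose D : seq (seq letter) := [seq z <- Z | size z == K.+2].
have DC : {in D, forall z, size z = K.+2 /\ circuit_edge w z}.
  by move=> z; rewrite mem_filter => /andP[/eqP-> /CZ].
have sD : size D = count (fun z : seq letter => size z == K.+2) Z.
  exact: size_filter.
have := subwords_growth (run := K < R) Kw (filter_uniq _ uZ) DC (runs K.+1).
rewrite -/D sD; move: (IHK (ltnW Kw)).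
have -> : count (fun z : seq letter => size z <= K.+2) Z =
    count (fun z => size z <= K.+1) Z + count (fun z => size z == K.+2) Z.
  by elim: (Z) => //= z Z' ->; lia.
by lia.
Qed.

Lemma powers_le_size (w : seq letter) (R : nat) : a \in w -> b \in w ->
  (forall n, 0 < n <= R -> returning_run w n) -> m w + R + 2 <= size w.
Proof.
move=> aw bw runs; have [Z [uZ <- CZ]] := powers_as_edges w.
(* With [K = size w], there are no factors of length [K.+1], and the right-hand side is just
   [size w]. *)
have := growth_sum uZ CZ runs (leqnn _).
have -> : size (subwords w (size w).+1) = 0.
  apply/eqP; rewrite size_eq0 -[_ == _]negbK -has_filter; apply/hasPn => v.
  by rewrite mem_factors => /size_infix; rewrite neq_ltn ltnS => ->.
have -> : count (fun z => size z <= (size w).+1) Z = size Z.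
  apply/eqP; rewrite -all_count; apply/allP => z /CZ[f [p [_ _ /(_ 0)/size_infix]]].
  by rewrite size_window => /leqW.
have Rw : R <= size w.
  case: (posnP R) => [->//|R0]; have [|i [j [_ + _ _]]] := runs R; last by lia.
  by rewrite R0 leqnn.
have letters : 2 <= size (subwords w 1).
  apply: (@uniq_leq_size _ [:: [:: a]; [:: b]]) => // v.
  have letter_subword x : x \in w -> [:: x] \in subwords w 1.
    case/splitPr => p s; rewrite mem_subwords; apply/infixP.
    by exists p, s.
  by rewrite !inE => /orP[]/eqP->; apply: letter_subword.
by rewrite (minn_idPl Rw); lia.
Qed.

(** * Runs of [a] in the block form of the word *)

Section Blocks.
Variables (k : nat) (F : nat -> nat).

Definition blocks_from i :=
  flatten [seq nseq (F l) a ++ [:: b] | l <- iota i (k - i)] ++ nseq (F k) a.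

Lemma blocks_from_split i j : i <= j <= k -> exists P S,
  blocks_from i = P ++ nseq (F j) a ++ S /\
  (j < k -> S = b :: blocks_from j.+1).
Proof.
move=> /andP[ij]; rewrite leq_eqVlt => /predU1P[->|jk]; rewrite /blocks_from.
  by exists (flatten [seq nseq (F l) a ++ [:: b] | l <- iota i (k - i)]), [::];
    rewrite cats0 ltnn.
have -> : k - i = (j - i) + (1 + (k - j.+1)) by lia.
rewrite !iotaD !map_cat !flatten_cat /= cats0 subnKC // addn1 -!catA.
by do 2 eexists; split.
Qed.

(** The two occurrences are the last [n] letters of block [i] with the [b] after them, and the first
    [n] letters of block [j]. *)
Lemma blocks_returning_run n i j : i < j <= k -> n <= F i -> n <= F j ->
  returning_run (blocks_from 0) n.
Proof.
move=> /andP[ij jk] ni nj.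
have [|P [S [-> eS]]] := @blocks_from_split 0 i; first by lia.
rewrite eS; last by lia.
have [|Q [S' [-> _]]] := @blocks_from_split i.+1 j; first by lia.
rewrite -(subnK ni) -(subnKC nj) !nseqD -!catA -cat_rcons.
set A := nseq (F i - n) a; set A' := nseq (F j - n) a.
exists (size (P ++ A)), (size (P ++ A ++ rcons (nseq n a) b ++ Q)); split.
- by rewrite !size_cat size_rcons; lia.
- by rewrite !size_cat size_rcons !size_nseq; lia.
- rewrite catA drop_size_cat // take_size_cat //.
  by rewrite size_rcons size_nseq.
- have -> : P ++ A ++ rcons (nseq n a) b ++ Q ++ nseq n a ++ A' ++ S' =
      (P ++ A ++ rcons (nseq n a) b ++ Q) ++ nseq n a ++ A' ++ S'.
    by rewrite -!catA.
  by rewrite drop_size_cat // take_size_cat // size_nseq.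
Qed.

End Blocks.

Lemma ab_word_blocks k (r : 'I_k.+1 -> nat) :
  ab_word r = blocks_from k (fun i => r (inord i)) 0.
Proof.
rewrite /ab_word /blocks_from subn0 -val_enum_ord -map_comp.
congr (flatten _ ++ nseq (r _) _); last by apply: val_inj; rewrite /= inordK.
apply: eq_map => i /=; congr (nseq (r _) _ ++ _).
by apply: val_inj; rewrite /= inordK // ltnS ltnW.
Qed.

Lemma ab_word_returning_run k (r : 'I_k.+1 -> nat) n (i j : 'I_k.+1) :
  i != j -> n <= r i -> n <= r j -> returning_run (ab_word r) n.
Proof.
rewrite ab_word_blocks => ne ni nj.
case: (ltngtP i j) => [lt|lt|/val_inj eq_ij]; last by rewrite eq_ij eqxx in ne.
- by apply: (@blocks_returning_run k _ n i j); rewrite ?inord_val // lt -ltnS ltn_ord.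
- by apply: (@blocks_returning_run k _ n j i); rewrite ?inord_val // lt -ltnS ltn_ord.
Qed.

Lemma b_in_ab_word k (r : 'I_k.+1 -> nat) : 0 < k -> b \in ab_word r.
Proof.
move=> k0; rewrite mem_cat; apply/orP; left; apply/flattenP.
pose i := Ordinal k0; exists (nseq (r (widen_ord (leqnSn k) i)) a ++ [:: b]).
  by apply/mapP; exists i; rewrite // mem_enum.
by rewrite mem_cat mem_head orbT.
Qed.

Theorem theorem3 (w : seq letter) (k : nat) (r : 'I_k.+1 -> nat)
    (hw : w = ab_word r) (hb : (0 < k)%N) (ha : a \in w)
    (sigma : {perm 'I_k.+1})
    (hsigma : forall i j : 'I_k.+1,
      (i <= j)%N -> (r (sigma i) <= r (sigma j))%N) :
  (((m w)%:Z + (r (sigma (inord k.-1)))%:Z)%R <= (size w)%:Z - 2)%R.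
Proof.
have ek : (inord k.-1 : 'I_k.+1) = k.-1 :> nat.
  by rewrite inordK // ltnS leq_pred.
have bw : b \in w by rewrite hw b_in_ab_word.
suff : m w + r (sigma (inord k.-1)) + 2 <= size w by lia.
apply: powers_le_size => // n /andP[_ nr]; rewrite hw.
(* With indices from 0, these are the blocks ranked [k] and [k + 1] in the sorted order, both of
   length at least [n]. *)
apply: (@ab_word_returning_run _ _ _ (sigma (inord k.-1)) (sigma ord_max)) => //.
  rewrite (inj_eq perm_inj); apply/eqP => /(congr1 val) /=; rewrite ek; lia.
by apply: leq_trans nr _; apply: hsigma; rewrite ek leq_pred.
Qed.
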